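(* Let $g,h\in\mathbb{F}_q[X]$ be coprime polynomials with $g$ monic of degree three and $h$ nonzero of degree less than three, and let $n$ be a positive integer. Let $\overline{U}(n,q)$ be the set of $\beta\in\mathbb{F}_{q^n}$ such that $g(X)-\beta h(X)$ is irreducible over $\mathbb{F}_{q^n}$. Then \[ |\overline{U}(n,q)|=\frac{N+A-C}{3}, \] where - $A$ is the number of distinct roots of $h$ in $\mathbb{F}_{q^n}$; - $C$ is the number of $\beta\in\mathbb{F}_{q^n}$ for which $g(X)-\beta h(X)$ has a triple root in $\mathbb{F}_{q^n}$; - $N$ is the number of solutions $(x,\beta)\in\mathbb{F}_{q^n}\times\mathbb{F}_{q^n}$ of the equation $x^2+s(\beta)x+t(\beta)=0$, whose left-hand side is the quadratic resolvent of the cubic polynomial $g(X)-\beta h(X)$. If $q$ is odd, then $N$ also equals the number of solutions $(y,\beta)\in\mathbb{F}_{q^n}\times\mathbb{F}_{q^n}$ of the equation $y^2-\Delta(\beta)=0$, where $\Delta(\beta)=\operatorname{Disc}_X\bigl(g(X)-\beta h(X)\bigr)$.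
   Context: The quadratic resolvent of a monic cubic polynomial $X^3+aX^2+bX+c$ is the polynomial $x^2+(ab-3c)x+(a^3c+b^3+9c^2-6abc)$. Thus, writing $g(X)-\beta h(X)=X^3+a(\beta)X^2+b(\beta)X+c(\beta)$, where $a,b,c$ are polynomials in $\beta$ over $\mathbb{F}_q$, one has $s=ab-3c$ and $t=a^3c+b^3+9c^2-6abc$. $\operatorname{Disc}_X$ denotes the discriminant with respect to $X$. *)

(* Defs.v *)
From HB Require Import structures.
From mathcomp Require Import all_boot all_order all_algebra.

Set Implicit Arguments.
Unset Strict Implicit.
Unset Printing Implicit Defensive.

Import GRing.Theory.
Local Open Scope ring_scope.

(* The discriminant of a monic polynomial f of degree d,
     (-1)^(d(d-1)/2) Res(f, f') = \prod_(i < j) (r_i - r_j)^2.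
   The library's [resultant p q] takes the shifts of p and q with increasing
   powers of the variable along rows and columns, so it equals the usual
   Res(q, p) = lead_coef(q)^(deg p) * \prod_(q(r) = 0) p(r); hence the order of
   the arguments, which matters when deg f * deg f' is odd (for instance for a
   cubic in characteristic 3).  As f is monic, using the actual degree of f',
   rather than d - 1, does not change the value. *)
Definition monic_disc (R : comNzRingType) (f : {poly R}) : R :=
  (-1) ^+ 'C((size f).-1, 2) * resultant f^`() f.

(* For f = X^3 + a X^2 + b X + c, the quadratic resolvent of f is
   x^2 + (resolvent_s f) x + (resolvent_t f). *)
Definition resolvent_s (R : comNzRingType) (f : {poly R}) : R :=
  let a := f`_2 in let b := f`_1 in let c := f`_0 in
  a * b - c *+ 3.

Definition resolvent_t (R : comNzRingType) (f : {poly R}) : R :=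
  let a := f`_2 in let b := f`_1 in let c := f`_0 in
  a ^+ 3 * c + b ^+ 3 + c ^+ 2 *+ 9 - (a * b * c) *+ 6.

(* g(X) - beta h(X) with beta an indeterminate: the outer variable is X, and
   the inner one, i.e. that of the coefficients, is beta. *)
Definition pencil (R : comNzRingType) (g h : {poly R}) : {poly {poly R}} :=
  g^:P - 'X *: h^:P.

Section Counting.

Variables (F L : finFieldType) (iota : {rmorphism F -> L}).

(* g(X) - beta h(X) for beta in L. *)
Definition fiber_poly (g h : {poly F}) (beta : L) : {poly L} :=
  map_poly iota g - beta *: map_poly iota h.

Definition irred_set (g h : {poly F}) : {set L} :=
  [set beta | irreducibleb (fiber_poly g h beta)].

Definition root_set (h : {poly F}) : {set L} :=
  [set x | root (map_poly iota h) x].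

Definition triple_root_set (g h : {poly F}) : {set L} :=
  [set beta | [exists r : L, mup r (fiber_poly g h beta) == 3]].

Definition resolvent_sols (g h : {poly F}) : {set L * L} :=
  let s := resolvent_s (pencil g h) in
  let t := resolvent_t (pencil g h) in
  [set z : L * L | let: (x, beta) := z in
     x ^+ 2 + (map_poly iota s).[beta] * x + (map_poly iota t).[beta] == 0].

Definition disc_sols (g h : {poly F}) : {set L * L} :=
  let Delta := monic_disc (pencil g h) in
  [set z : L * L | let: (y, beta) := z in
     y ^+ 2 - (map_poly iota Delta).[beta] == 0].

End Counting.

(* Main.v *)
Require Import Defs.
From HB Require Import structures.
From mathcomp Require Import all_boot all_order all_algebra.
From mathcomp Require Import fieldext finfield.
From mathcomp Require Import ring.

Set Implicit Arguments.
Unset Strict Implicit.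
Unset Printing Implicit Defensive.

Import GRing.Theory.
Local Open Scope ring_scope.

(** The count is a sum over the parameter beta of an identity about a single
    monic cubic f over the finite field L, [cubic_count]:
<<
      3 [f irreducible] + #{roots of f} + [f has a triple root]
        = #{roots of the quadratic resolvent of f} + 1.
>>
    Over a splitting field, with r1, r2, r3 the roots of f, the roots of the
    resolvent are the two cyclic sums
<<
      r1^2 r2 + r2^2 r3 + r3^2 r1    and    r2^2 r1 + r3^2 r2 + r1^2 r3,
>>
    whose difference is (r1 - r2)(r2 - r3)(r1 - r3) up to sign.

    If f has no root in L, it is irreducible, and Frobenius permutes its three
    roots cyclically; it fixes both cyclic sums, which therefore lie in L, and
    they are distinct: both sides equal 3 ([count_without_root]).  If f has a
    root r in L, write f = (X - r) q with q quadratic, and let d = q(r).  An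
    affine substitution x = k + d z turns the resolvent into d^2 q(z)
    ([resolvent_shift]).  When d is nonzero, the resolvent has as many roots as
    q, one fewer than f; when d = 0, it is a square, and f = (X - r)^2 (X - w)
    has one or two roots according as it has a triple root or not
    ([count_with_root]).

    Summing over beta, the numbers of roots of g - beta h are obtained by
    exchanging the roles of x and beta: a point x with h(x) <> 0 is a root for
    exactly one beta, namely g(x)/h(x), and a root of h is a root for no beta,
    as g and h are coprime.  So they add up to |L| - A ([sum_zeros]), and
    3 |U| + (|L| - A) + C = N + |L|.

    Finally the discriminant of a monic cubic equals s^2 - 4t
    ([monic_disc_cubic]), so in odd characteristic completing the square, that
    is y = 2x + s, matches the two kinds of solutions. *)

(** * Resultants as explicit determinants *)

(** A cofactor expansion along the first row that reduces by computation: the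
    entries are indexed by natural numbers, so that deleting a row and a column
    changes only the entry function and not the type. *)
Fixpoint laplace_det (R : comNzRingType) n (E : nat -> nat -> R) : R :=
  if n is m.+1 then
    foldr (fun j s => E 0 j *
      ((-1) ^+ j * laplace_det m (fun i k => E i.+1 (bump j k))) + s)
      0 (iota 0 n)
  else 1.

Lemma det_laplace (R : comNzRingType) n (E : nat -> nat -> R) :
  \det (\matrix_(i < n, j < n) E i j) = laplace_det n E.
Proof.
elim: n E => [|n IHn] E; first by rewrite det_mx00.
transitivity (\sum_(0 <= j < n.+1) E 0 j *
    ((-1) ^+ j * laplace_det n (fun i k => E i.+1 (bump j k)))); last first.
  by rewrite unlock /index_iota subn0.
rewrite (expand_det_row _ ord0) big_mkord; apply: eq_bigr => j _.
rewrite mxE /cofactor add0n -IHn; congr (_ * (_ * \det _)).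
by apply/matrixP=> i k; rewrite !mxE.
Qed.

(** The entries of [Sylvester_mx], with n the degree of the second polynomial:
    n shifts of p, followed by shifts of q. *)
Definition sylvester (R : comNzRingType) n (p q : nat -> R) i j : R :=
  if (i < n)%N then (if (i <= j)%N then p (j - i)%N else 0)
  else (if (i - n <= j)%N then q (j - (i - n))%N else 0).

Lemma resultant_laplace (R : comNzRingType) m n (p q : {poly R}) :
    (size p).-1 = m -> (size q).-1 = n ->
  resultant p q =
    laplace_det (n + m) (sylvester n (nth 0 p) (nth 0 q)).
Proof.
move=> <- <-; rewrite -det_laplace /resultant; congr (\det _).
apply/matrixP => i j; rewrite Sylvester_mxE mxE /sylvester -!mulrb.
by case: splitP => k ->; rewrite ?addKn.
Qed.

(** * The discriminant of a cubic *)

(** The Sylvester matrix has size 3 + deg f', and deg f' = 2 unless 3 = 0.  In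
    characteristic 3 the derivative is 2 a X + b, of degree 1 unless a = 0; the
    determinants for these smaller degrees agree with s^2 - 4t only modulo 3. *)
Lemma monic_disc_cubic (R : idomainType) (f : {poly R}) :
    f \is monic -> size f = 4%N ->
  monic_disc f = resolvent_s f ^+ 2 - 4 * resolvent_t f.
Proof.
move=> /monicP; rewrite lead_coefE => lf sf; rewrite sf /= in lf.
have seq_f : f = [:: f`_0; f`_1; f`_2; 1] :> seq R.
  by apply: (@eq_from_nth _ 0) => [|[|[|[|[|i]]]]]; rewrite ?sf ?lf.
have df : f^`() = Poly [:: f`_1; f`_2 *+ 2; 3].
  apply/polyP=> i; rewrite coef_deriv coef_Poly.
  case: i => [|[|[|i]]] //=; first by rewrite lf.
  by rewrite [f`_i.+4]nth_default ?sf // mul0rn nth_nil.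
rewrite /monic_disc sf /= /resolvent_s /resolvent_t.
move: (f`_0) (f`_1) (f`_2) seq_f df => c b a seq_f df.
(* If 3 = 0, the signed determinant is s^2 - 4t + 3K as an integer polynomial
   in a, b, c, with a = 0 in the case where f' is constant. *)
pose K := b ^+ 3 - a ^+ 2 * b ^+ 2 + 4 * a ^+ 3 * c + 9 * c ^+ 2 -
  6 * a * b * c.
have sf3 : (size f).-1 = 3%N by rewrite sf.
have seq_df := congr1 polyseq df.
rewrite /= !polyseq_cons !polyseqC eqxx /= in seq_df.
have [c3|c3] := eqVneq (3 : R) 0; last first.
  rewrite c3 /= in seq_df.
  have sd : (size f^`()).-1 = 2%N by rewrite seq_df.
  rewrite (resultant_laplace sd sf3) /=.
  rewrite /sylvester seq_f seq_df /=.
  by ring.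
rewrite c3 eqxx /= in seq_df.
rewrite -[RHS]addr0 -[0 in RHS](mul0r K) -c3 /K.
have [a0|a0] := eqVneq (a *+ 2) 0; last first.
  rewrite a0 /= in seq_df.
  have sd : (size f^`()).-1 = 1%N by rewrite seq_df.
  rewrite (resultant_laplace sd sf3) /= /sylvester seq_f seq_df /=.
  by ring.
have {}a0 : a = 0.
  have -> : a = 3 * a - a *+ 2 by ring.
  by rewrite c3 a0 mul0r subr0.
rewrite a0 mul0rn eqxx /= in seq_df *.
have sd : (size f^`()).-1 = 0%N by rewrite seq_df; case: eqP.
have {}seq_df i : f^`()`_i = if i is 0%N then b else 0.
  by rewrite seq_df; case: eqVneq => [->|_]; case: i => [|[]].
rewrite (resultant_laplace sd sf3) /= /sylvester seq_f !seq_df /=.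
by ring.
Qed.

(** * The resolvent of a cubic with a root in the base field *)

Lemma monic_cubic_horner (R : comNzRingType) (f : {poly R}) (x : R) :
  f \is monic -> size f = 4%N ->
  f.[x] = x ^+ 3 + f`_2 * x ^+ 2 + f`_1 * x + f`_0.
Proof.
move=> /monicP; rewrite lead_coefE => lf sf; rewrite sf /= in lf.
rewrite horner_coef sf !big_ord_recr big_ord0 /= lf.
by ring.
Qed.

Lemma triple_rootE (L : fieldType) (f : {poly L}) (r : L) :
  f \is monic -> size f = 4%N -> (mup r f == 3%N) = (f == ('X - r%:P) ^+ 3).
Proof.
move=> mf sf; apply/eqP/eqP => [mu3|->]; last by rewrite mup_XsubCX eqxx.
have f0 : f != 0 by rewrite monic_neq0.
have dvd3 : ('X - r%:P) ^+ 3 %| f by rewrite -mup_geq ?mu3.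
have := dvdp_size_eqp dvd3; rewrite size_exp_XsubC sf eqxx => /esym.
by rewrite eqp_monic ?monic_exp ?monicXsubC // => /eqP.
Qed.

Definition resolvent_roots (L : finFieldType) (f : {poly L}) : {set L} :=
  [set x | x ^+ 2 + resolvent_s f * x + resolvent_t f == 0].

Definition zeros (L : finFieldType) (f : {poly L}) : {set L} :=
  [set x | root f x].

(** Here f = (X - r)(X^2 + u X + v) and d is the value at r of the quadratic
    factor.  If p and w are the roots of that factor, then the root
    r^2 p + p^2 w + w^2 r of the resolvent is r (u^2 - v) + d p, as one sees by
    eliminating w = - u - p and reducing p^2 = - u p - v.  Putting y = d z, the
    right-hand side is d^2 (z^2 + u z + v). *)
Lemma resolvent_shift (R : comNzRingType) (f : {poly R}) (r u v : R) :
    f`_2 = u - r -> f`_1 = v - u * r -> f`_0 = - (v * r) -> forall y,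
  let d := r ^+ 2 + u * r + v in
  let x := r * (u ^+ 2 - v) + y in
  x ^+ 2 + resolvent_s f * x + resolvent_t f = y ^+ 2 + d * u * y + d ^+ 2 * v.
Proof.
by move=> f2 f1 f0 y /=; rewrite /resolvent_s /resolvent_t f2 f1 f0; ring.
Qed.

Lemma monic_quadratic (R : comNzRingType) (q : {poly R}) :
  q \is monic -> size q = 3%N -> q = 'X^2 + q`_1 *: 'X + (q`_0)%:P.
Proof.
move=> /monicP; rewrite lead_coefE => lq sq; rewrite sq /= in lq.
apply/polyP => i; rewrite !(coefD, coefXn, coefZ, coefX, coefC).
case: i => [|[|[|i]]] /=; rewrite ?lq; last by rewrite nth_default ?sq //; ring.
all: by ring.
Qed.

Lemma count_with_root (L : finFieldType) (f : {poly L}) (r : L) :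
    f \is monic -> size f = 4%N -> root f r ->
  (3 * irreducibleb f + #|zeros f| + [exists r, mup r f == 3%N] =
   #|resolvent_roots f| + 1)%N.
Proof.
move=> mf sf fr.
have irrF : irreducibleb f = false.
  apply/irreducibleP => -[_ /(_ ('X - r%:P))].
  rewrite size_XsubC dvdp_XsubCl => /(_ (erefl _) fr)/eqp_size.
  by rewrite size_XsubC sf.
have tripleE : [exists s, mup s f == 3%N] = (f == ('X - r%:P) ^+ 3).
  apply/existsP/eqP => [[s] | ->]; last by exists r; rewrite mup_XsubCX eqxx.
  rewrite triple_rootE // => /eqP fE; move: fr.
  by rewrite fE rootE horner_exp !hornerE expf_eq0 subr_eq0 => /eqP ->.
rewrite irrF tripleE muln0 add0n.
have /factor_theorem[q fE] := fr.
have mq : q \is monic by move: mf; rewrite fE monicMr ?monicXsubC.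
have sq : size q = 3%N.
  move: sf; rewrite fE size_Mmonic ?monicXsubC ?monic_neq0 //.
  by rewrite size_XsubC addn2 => -[].
have qE := monic_quadratic mq sq.
set u := q`_1 in qE; set v := q`_0 in qE.
have q2 : q`_2 = 1 by move/monicP: mq; rewrite lead_coefE sq.
have f2 : f`_2 = u - r by rewrite fE mulrBr coefB coefMX coefMC /= q2 mul1r.
have f1 : f`_1 = v - u * r by rewrite fE mulrBr coefB coefMX coefMC.
have f0 : f`_0 = - (v * r) by rewrite fE mulrBr coefB coefMX coefMC /= sub0r.
have shift := resolvent_shift f2 f1 f0.
have qx x : q.[x] = x ^+ 2 + u * x + v by rewrite qE !hornerE.
have zf x : (x \in zeros f) = (x == r) || (q.[x] == 0).
  by rewrite inE fE rootM root_XsubC orbC.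
pose k := r * (u ^+ 2 - v); pose d := r ^+ 2 + u * r + v.
have [d0|d_neq0] := eqVneq d 0.
  (* r is also a root of q, and the resolvent is (x - k)^2. *)
  have -> : resolvent_roots f = [set k].
    apply/setP => x; rewrite !inE -[x](subrK k) (addrC _ k) shift -/d d0.
    by rewrite !(mul0r, expr0n, addr0) sqrf_eq0 addrC subrK subr_eq0.
  pose w := - u - r.
  have q_split : q = ('X - r%:P) * ('X - w%:P).
    have -> : q = 'X^2 + u *: 'X + (- (r ^+ 2 + u * r))%:P.
      rewrite {1}qE; congr (_ + _%:P).
      by rewrite -[v]addr0 -[0]oppr0 -d0 /d; ring.
    by rewrite /w -mul_polyC !(polyCD, polyCN, polyCM, polyC_exp); ring.
  have -> : zeros f = [set r; w].
    apply/setP => x; rewrite zf !inE q_split !hornerE mulf_eq0 !subr_eq0.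
    by rewrite orbA orbb.
  have -> : (f == ('X - r%:P) ^+ 3) = (r == w).
    rewrite fE q_split exprSr expr2 (inj_eq (mulIf _)) ?polyXsubC_eq0 //.
    rewrite (inj_eq (mulfI _)) ?polyXsubC_eq0 // (inj_eq (addrI _)) eqr_opp.
    by rewrite (inj_eq polyC_inj) eq_sym.
  by rewrite cards2 cards1; case: eqP.
(* r is a simple root, and z |-> k + d z maps the roots of q onto those of the
   resolvent. *)
have qr : q.[r] != 0 by rewrite qx.
have -> : zeros f = r |: zeros q.
  by apply/setP => x; rewrite zf !inE.
have -> : (f == ('X - r%:P) ^+ 3) = false.
  apply: contraNF qr; rewrite fE exprSr (inj_eq (mulIf _)) ?polyXsubC_eq0 //.
  by move/eqP->; rewrite horner_exp !hornerE subrr expr0n.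
have -> : resolvent_roots f = [set k + d * z | z in zeros q].
  apply/setP => x; rewrite inE; apply/eqP/imsetP => [x0 | [z]].
    pose z := d^-1 * (x - k).
    have xE : x = k + d * z by rewrite mulVKf // addrC subrK.
    exists z => //; rewrite inE rootE qx.
    rewrite -(mulrI_eq0 _ (mulfI (expf_neq0 2 d_neq0))).
    by apply/eqP; rewrite -x0 xE shift -/d; ring.
  rewrite inE rootE qx => /eqP qz ->.
  by rewrite shift -/d -[0](mulr0 (d ^+ 2)) -qz; ring.
rewrite card_imset; last by move=> x y /addrI /(mulfI d_neq0).
by rewrite cardsU1 inE rootE qr /= addn0 add1n addn1.
Qed.

(** * The resolvent of an irreducible cubic *)

Section Frobenius.

Variables (L : finFieldType) (M : fieldExtType L).

Definition frobenius (x : M) : M := x ^+ #|L|.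

Fact frobenius_zmod_morphism : zmod_morphism frobenius.
Proof.
have [p p_pr pcharLp] := finPcharP L.
have pcharM : p \in [pchar M] by rewrite pchar_lalg.
have frobeniusD x y : frobenius (x + y) = frobenius x + frobenius y.
  rewrite /frobenius exprDn_pchar // (card_pprimeChar pcharLp).
  by rewrite pnatX (pi_pnat _ pcharM) ?pnat_id.
by move=> x y; rewrite -[in RHS](subrK y x) [in RHS]frobeniusD addrK.
Qed.

Fact frobenius_monoid_morphism : monoid_morphism frobenius.
Proof. by split=> [|x y]; rewrite /frobenius ?expr1n ?exprMn. Qed.

HB.instance Definition _ :=
  GRing.isZmodMorphism.Build M M frobenius frobenius_zmod_morphism.
HB.instance Definition _ :=
  GRing.isMonoidMorphism.Build M M frobenius frobenius_monoid_morphism.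

(** The elements fixed by Frobenius are the roots of X^|L| - X, which already
    splits over L. *)
Lemma frobenius_fixed (x : M) : frobenius x = x <-> exists a : L, x = a%:A.
Proof.
split=> [xQ | [a ->]]; last first.
  by rewrite /frobenius -[a%:A]/(in_alg M a) -rmorphXn /= expf_card.
have : root (map_poly (in_alg M) ('X^#|L| - 'X)) x.
  rewrite rootE rmorphB /= map_polyXn map_polyX !hornerE.
  by rewrite -/(frobenius x) xQ subrr.
rewrite finField_genPoly rmorph_prod rootE horner_prod prodf_seq_eq0.
case/hasP => a _ /=; rewrite rmorphB /= map_polyX map_polyC !hornerE subr_eq0.
by move/eqP->; exists a.
Qed.

(** Frobenius as an abstract morphism, known by its fixed field: the power
    x^|L| must not unfold in the computations that follow. *)
Lemma exists_frobenius :
  exists phi : {rmorphism M -> M},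
    forall x, phi x = x <-> exists a : L, x = a%:A.
Proof. by exists frobenius; apply: frobenius_fixed. Qed.

End Frobenius.

(** Two distinct roots determine the whole factorization, the third root being
    given by the sum of the roots: dividing f(r) - f(s) = 0 by r - s gives the
    value of b. *)
Lemma cubic_two_roots (R : idomainType) (a b c r s x : R) :
    r != s ->
    r ^+ 3 + a * r ^+ 2 + b * r + c = 0 ->
    s ^+ 3 + a * s ^+ 2 + b * s + c = 0 ->
  let t := - a - r - s in
  [/\ b = r * s + s * t + t * r, c = - (r * s * t)
    & x ^+ 3 + a * x ^+ 2 + b * x + c = (x - r) * (x - s) * (x - t)].
Proof.
move=> rs r0 s0 t.
have bE : b = r * s + s * t + t * r.
  apply: (mulfI (_ : r - s != 0)); first by rewrite subr_eq0.
  rewrite -[LHS]addr0 -[0](subrr 0) -{1}s0 -r0 /t; ring.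
have cE : c = - (r * s * t).
  by rewrite -[LHS]subr0 -r0 bE /t; ring.
by split=> //; rewrite bE cE /t; ring.
Qed.

(** Adjoin a root r of f and let s = phi r and t = phi s, where phi is
    Frobenius.  No root of f is fixed by phi.  If t were r, then phi would
    exchange r and s, hence fix the third root - a - r - s.  So r, s and t are
    the three roots, and phi t, which is a root other than t and other than
    s = phi r, is r. *)
Lemma count_without_root (L : finFieldType) (f : {poly L}) :
    f \is monic -> size f = 4%N -> (forall r, ~~ root f r) ->
  (3 * irreducibleb f + #|zeros f| + [exists r, mup r f == 3%N] =
   #|resolvent_roots f| + 1)%N.
Proof.
move=> mf sf f_noroot.
have irrf : irreducible_poly f by apply: cubic_irreducible; rewrite ?sf.
have -> : irreducibleb f by apply/irreducibleP.
have -> : zeros f = set0.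
  by apply/setP => x; rewrite !inE; apply: negbTE.
have -> : [exists r, mup r f == 3%N] = false.
  by apply/existsP => -[r]; rewrite mupNroot.
rewrite cards0.
have [M _ [r root_r _]] := irredp_FAdjoin irrf.
have rmorphE := (rmorphB, rmorphN, rmorphD, rmorphXn, rmorphM, rmorphMn).
have [phi phi_fixed] := exists_frobenius M.
have phiA x : phi x%:A = x%:A by apply/phi_fixed; exists x.
pose a : M := (f`_2)%:A; pose b : M := (f`_1)%:A; pose c : M := (f`_0)%:A.
pose F (x : M) := x ^+ 3 + a * x ^+ 2 + b * x + c.
have FE x : (map_poly (in_alg M) f).[x] = F x.
  rewrite monic_cubic_horner ?map_monic ?size_map_poly //.
  by rewrite !coef_map.
have Fphi x : F x = 0 -> F (phi x) = 0.
  move=> /(congr1 phi); rewrite rmorph0 => <-.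
  by rewrite /F !rmorphE !phiA.
have F_notin x : F x%:A != 0.
  rewrite -FE -[x%:A]/(in_alg M x) horner_map fmorph_eq0; exact: f_noroot.
have Fr : F r = 0 by rewrite -FE; apply/eqP.
set s := phi r; set t := phi s.
have Fs : F s = 0 := Fphi _ Fr.
have Ft : F t = 0 := Fphi _ Fs.
have nfix x : F x = 0 -> phi x != x.
  move=> Fx; apply/eqP => /phi_fixed[y yE].
  by move: (F_notin y); rewrite -yE Fx eqxx.
have rs : r != s by rewrite eq_sym nfix.
have st : s != t by rewrite eq_sym nfix.
have [bE cE _] := cubic_two_roots 0 rs Fr Fs.
set w := - a - r - s in bE cE.
have Fxw x : F x = (x - r) * (x - s) * (x - w).
  by have [_ _] := cubic_two_roots x rs Fr Fs.
have phiw : phi w = - a - s - t.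
  apply: (addIr (phi r + phi s)); rewrite -/s -/t.
  have -> : - a - s - t + (s + t) = (- f`_2)%:A by rewrite /a scaleNr; ring.
  rewrite -phiA /s /t -!rmorphD; congr (phi _).
  by rewrite /w /a scaleNr; ring.
(* Otherwise w, the root of f besides r and s, would be fixed. *)
have tr : t != r.
  apply: contra_eq_neq phiw => ->.
  rewrite -[X in _ != X](_ : w = _); last first.
    by rewrite /w; ring.
  by apply: nfix; rewrite Fxw subrr mulr0.
have tw : t = w.
  have := Ft; rewrite Fxw => /eqP; rewrite !mulf_eq0 !subr_eq0.
  by rewrite (negPf tr) eq_sym (negPf st) => /eqP.
have phit : phi t = r.
  have := Fphi _ Ft; rewrite Fxw => /eqP; rewrite -tw !mulf_eq0 !subr_eq0.
  rewrite (negPf (nfix _ Ft)) orbF => /orP[/eqP//|/eqP /fmorph_inj ts].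
  by rewrite ts eqxx in tr.
pose x1 := r ^+ 2 * s + s ^+ 2 * t + t ^+ 2 * r.
pose x2 := s ^+ 2 * r + t ^+ 2 * s + r ^+ 2 * t.
have [y1 y1E] : exists y, x1 = y%:A.
  apply/phi_fixed; rewrite /x1 !rmorphE -/s -/t phit; ring.
have [y2 y2E] : exists y, x2 = y%:A.
  apply/phi_fixed; rewrite /x2 !rmorphE -/s -/t phit; ring.
have aE : a = - (r + s + t) by rewrite tw /w; ring.
have y12 : y1 != y2.
  rewrite -(inj_eq (fmorph_inj (in_alg M))) /= -y1E -y2E -subr_eq0.
  have -> : x1 - x2 = (r - s) * (s - t) * (r - t) by rewrite /x1 /x2; ring.
  by rewrite !mulf_neq0 ?subr_eq0 // eq_sym.
have sE : resolvent_s f = - (y1 + y2).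
  apply: (fmorph_inj (in_alg M)); rewrite /resolvent_s !rmorphE /=.
  by rewrite -y1E -y2E -/a -/b -/c cE bE -tw aE /x1 /x2; ring.
have tE : resolvent_t f = y1 * y2.
  apply: (fmorph_inj (in_alg M)); rewrite /resolvent_t !rmorphE /=.
  by rewrite -y1E -y2E -/a -/b -/c cE bE -tw aE /x1 /x2; ring.
have -> : resolvent_roots f = [set y1; y2].
  apply/setP => x; rewrite !inE -[x == y1]subr_eq0 -[x == y2]subr_eq0.
  rewrite -mulf_eq0 sE tE.
  by congr (_ == _); ring.
by rewrite cards2 y12.
Qed.

Lemma cubic_count (L : finFieldType) (f : {poly L}) :
    f \is monic -> size f = 4%N ->
  (3 * irreducibleb f + #|zeros f| + [exists r, mup r f == 3%N] =
   #|resolvent_roots f| + 1)%N.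
Proof.
move=> mf sf.
have [/existsP[r fr]|/existsPn noroot] := boolP [exists r, root f r].
  exact: count_with_root fr.
exact: count_without_root.
Qed.

(** * Summation over the pencil *)

Lemma card_fibers (S T : finType) (A : T -> {set S}) :
  #|[set z : S * T | z.1 \in A z.2]| = (\sum_t #|A t|)%N.
Proof.
rewrite -sum1_card; under [RHS]eq_bigr => t _ do rewrite -sum1_card.
rewrite (exchange_big_dep xpredT) //= pair_big_dep /=.
by apply: eq_bigl => -[x t]; rewrite !inE.
Qed.

Lemma sum_card_exchange (S T : finType) (A : T -> {set S}) :
  (\sum_t #|A t| = \sum_x #|[set t | x \in A t]|)%N.
Proof.
under eq_bigr => t _ do rewrite -sum1_card.
rewrite (exchange_big_dep xpredT) //=; apply: eq_bigr => x _.
by rewrite -sum1_card; apply: eq_bigl => t; rewrite inE.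
Qed.

Section Morphism.

Variables (R S : comNzRingType) (phi : {rmorphism R -> S}).

Let rmorphE := (rmorphB, rmorphD, rmorphXn, rmorphM, rmorphMn).

Lemma resolvent_s_rmorph f : phi (resolvent_s f) = resolvent_s (map_poly phi f).
Proof. by rewrite /resolvent_s !coef_map !rmorphE. Qed.

Lemma resolvent_t_rmorph f : phi (resolvent_t f) = resolvent_t (map_poly phi f).
Proof. by rewrite /resolvent_t !coef_map !rmorphE. Qed.

End Morphism.

Section Pencil.

Variables (F L : finFieldType) (iota : {rmorphism F -> L}) (g h : {poly F}).
Hypotheses (g_monic : g \is monic) (size_g : size g = 4%N).
Hypotheses (size_h : (size h < 4)%N).

Local Notation f := (fiber_poly iota g h).

Lemma size_fiber beta : size (f beta) = 4%N.
Proof.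
rewrite size_polyDl ?size_polyN size_map_poly // size_g.
by rewrite (leq_ltn_trans (size_scale_leq _ _)) ?size_map_poly.
Qed.

Lemma fiber_monic beta : f beta \is monic.
Proof.
rewrite monicE lead_coefE size_fiber coefB coefZ !coef_map /=.
rewrite [h`_3]nth_default // rmorph0 mulr0 subr0.
by move/monicP: g_monic; rewrite lead_coefE size_g /= => ->; rewrite rmorph1.
Qed.

Lemma size_pencil : size (pencil g h) = 4%N.
Proof.
rewrite size_polyDl ?size_polyN size_map_polyC // size_g.
by rewrite (leq_ltn_trans (size_scale_leq _ _)) ?size_map_polyC.
Qed.

Lemma pencil_monic : pencil g h \is monic.
Proof.
rewrite monicE lead_coefE size_pencil coefB coefZ !coef_map /=.
rewrite [h`_3]nth_default // mulr0 subr0.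
by move/monicP: g_monic; rewrite lead_coefE size_g /= => ->.
Qed.

(** Evaluation at beta of the polynomials in the parameter, as a ring morphism:
    it commutes with every polynomial expression in the coefficients. *)
Definition specialization (beta : L) : {poly F} -> L :=
  horner_morph (fun a => mulrC beta (iota a) : GRing.comm beta (iota a)).

HB.instance Definition _ beta := GRing.RMorphism.on (specialization beta).

Lemma specialize_pencil beta :
  map_poly (specialization beta) (pencil g h) = f beta.
Proof.
apply/polyP=> i; rewrite coef_map !(coefB, coefZ) !coef_map /=.
by rewrite /specialization rmorphB rmorphM /= horner_morphX !horner_morphC.
Qed.

Lemma card_resolvent_sols :
  #|resolvent_sols iota g h| = (\sum_beta #|resolvent_roots (f beta)|)%N.
Proof.
rewrite -(card_fibers (fun beta => resolvent_roots (f beta))).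
apply: eq_card => -[x beta].
by rewrite !inE -specialize_pencil -resolvent_s_rmorph -resolvent_t_rmorph.
Qed.

(** A point x is a root of g - beta h for the single value beta = g(x)/h(x) if
    h(x) <> 0, and for none if h(x) = 0, since then g(x) <> 0. *)
Lemma sum_zeros : coprimep g h ->
  (\sum_beta #|zeros (f beta)| + #|root_set iota h| = #|L|)%N.
Proof.
move=> gh; rewrite sum_card_exchange.
rewrite -(cardsC (root_set iota h)) addnC; congr (_ + _)%N.
rewrite -[RHS]sum1_card [RHS]big_mkcond /=; apply: eq_bigr => x _.
set gx := (map_poly iota g).[x]; set hx := (map_poly iota h).[x].
have fx beta : root (f beta) x = (beta * hx == gx).
  by rewrite rootE !hornerE subr_eq0 eq_sym.
rewrite !inE rootE -/hx; have [hx0 | hx0] := eqVneq hx 0.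
  apply: eq_card0 => beta; rewrite !inE fx hx0 mulr0 eq_sym; apply/negP => gx0.
  have /coprimep_root/(_ gx0) : coprimep (map_poly iota g) (map_poly iota h).
    by rewrite coprimep_map.
  by rewrite -/hx hx0 eqxx.
apply/eqP/cards1P; exists (gx / hx); apply/setP => beta.
by rewrite !inE fx (can2_eq (mulfK hx0) (divfK hx0)).
Qed.

(** With y = 2x + s one has y^2 - (s^2 - 4t) = 4 (x^2 + s x + t). *)
Lemma card_disc_sols : (2 : L) != 0 ->
  #|disc_sols iota g h| = #|resolvent_sols iota g h|.
Proof.
move=> two; pose y (z : L * L) := (2 * z.1 + resolvent_s (f z.2), z.2).
have y_inj : injective y.
  move=> [x beta] [x' beta'] [+ eq_beta].
  by rewrite -eq_beta => /addIr /(mulfI two) ->.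
rewrite -(card_preimset _ y_inj); apply: eq_card => -[x beta].
rewrite !inE /= monic_disc_cubic ?pencil_monic ?size_pencil //.
rewrite -![(map_poly iota _).[beta]]/(specialization beta _).
have -> s t : specialization beta (s ^+ 2 - 4 * t) =
    specialization beta s ^+ 2 - 4 * specialization beta t.
  by rewrite rmorphB rmorphXn rmorphM rmorph_nat.
rewrite !(resolvent_s_rmorph, resolvent_t_rmorph) specialize_pencil.
rewrite -[RHS](mulrI_eq0 _ (mulfI (mulf_neq0 two two))).
by congr (_ == 0); ring.
Qed.

End Pencil.

Theorem lemma8 (F L : finFieldType) (iota : {rmorphism F -> L}) (n : nat)
    (n_gt0 : (0 < n)%N) (card_L : #|L| = (#|F| ^ n)%N)
    (g h : {poly F}) (g_monic : g \is monic) (size_g : size g = 4%N)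
    (h_neq0 : h != 0) (size_h : (size h < 4)%N) (gh_coprime : coprimep g h) :
  let N := #|resolvent_sols iota g h| in
  let A := #|root_set iota h| in
  let C := #|triple_root_set iota g h| in
  (#|irred_set iota g h|%:R : rat) = (N%:R + A%:R - C%:R) / 3%:R
  /\ (odd #|F| -> N = #|disc_sols iota g h|).
Proof.
move=> N A C; split; last first.
  move=> oddF; rewrite (card_disc_sols _ g_monic size_g size_h) //.
  rewrite -(rmorph_nat iota) fmorph_eq0.
  apply: contraTN oddF => two0.
  have pchar2 : 2%N \in [pchar F] by rewrite inE.
  have := finNzRing_gt1 F; rewrite (card_pprimeChar pchar2) oddX.
  by case: (logn _ _).
have cardE (P : pred L) : #|[set beta | P beta]| = (\sum_beta P beta)%N.
  rewrite -sum1_card big_mkcond; apply: eq_bigr => x _.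
  by rewrite inE; case: (P x).
have key : (3 * #|irred_set iota g h| + C = N + A)%N.
  apply: (@addIn (\sum_beta #|zeros (fiber_poly iota g h beta)|)).
  rewrite -[(N + A + _)%N]addnA [(A + _)%N]addnC sum_zeros //.
  have -> : #|L| = (\sum_(beta : L) 1)%N by rewrite -sum1_card; apply: eq_bigl.
  rewrite /N card_resolvent_sols -big_split /=.
  rewrite /C !cardE big_distrr /= -!big_split /=.
  apply: eq_bigr => beta _.
  have := cubic_count (fiber_monic iota g_monic size_g size_h beta)
     (size_fiber iota size_g size_h beta).
  by move <-; rewrite addnAC.
have -> : N%:R + A%:R - C%:R = 3%:R * (#|irred_set iota g h|)%:R :> rat.
  by rewrite -natrD -key natrD natrM addrK.
by rewrite mulrC mulKf.
Qed.
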